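(* Let $k\ge2$ be an integer and for $n\ge0$ let $$m_n(\infty) = \frac{1}{2\pi}\int_0^{4(k-1)/k^2} x^{n-1/2}\,\frac{\sqrt{4(k-1)-k^2x}}{1-x}\,dx .$$ For each $n\ge0$ there is a polynomial $\mathscr{P}_n$ of degree $n$ such that $$\frac{d^n}{dz^n}\left[\frac{z^n}{1+\sqrt z}\right] = \frac{\mathscr{P}_n(\sqrt z)}{2^n(1+\sqrt z)^{n+1}},\quad z>0,$$ and $$m_n(\infty) = \frac{2(k-1)^{n+1}}{k^{2n+1}}\left\{\binom{2n}{n} - \frac{(k-2)}{2\,n!\,(k-1)^{n+1}}\,k^n\,\mathscr{P}_n\left(\frac{k-2}{k}\right)\right\}.$$
   Context: $m_n(\infty)$ is the $n$-th moment of the probability measure $\tilde\mu_\infty^k(dx) = \frac{1}{2\pi}\frac{\sqrt{4(k-1)x-k^2x^2}}{x(1-x)}{\bf 1}_{[0,4(k-1)/k^2]}(x)\,dx$, the spectral distribution of $PU_\infty PU_\infty^{\star}P$ in the compressed space $(P\mathscr{A}P,k\tau)$, where $(\mathscr{A},\tau)$ is a tracial non commutative probability space, $P$ is a self-adjoint projection with $\tau(P)=1/k$ and $U_\infty$ is a Haar unitary free from $P$. *)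

(* Defs.v *)
From mathcomp Require Import all_boot all_order all_algebra.
From mathcomp Require Import all_classical all_reals all_analysis.
Import numFieldNormedType.Exports.

Set Implicit Arguments.
Unset Strict Implicit.
Unset Printing Implicit Defensive.

Import Order.TTheory GRing.Theory Num.Theory.

Local Open Scope classical_set_scope.
Local Open Scope ring_scope.

(* The integrand may be singular at an endpoint: at 0 when n = 0, and at the
   right endpoint, which is 1, when k = 2.  The Lebesgue integral is taken over
   the open interval so that the conventions for [powR] at 0 and for division
   by 0 play no role.  It is valued in the extended reals, so that an equality
   with a real number also asserts that it is finite. *)
Definition moment_infty (R : realType) (k n : nat) : \bar R :=
  (((2 * pi)^-1)%:E *
   \int[lebesgue_measure]_(x in
       `]0%R, (4 * (k%:R - 1) / k%:R ^+ 2)%R[%classic)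
     (x `^ (n%:R - 2^-1) *
      (Num.sqrt (4 * (k%:R - 1) - k%:R ^+ 2 * x) / (1 - x)))%R%:E)%E.

(* Main.v *)
Require Import Defs.
From mathcomp Require Import all_boot all_order all_algebra.
From mathcomp Require Import all_classical all_reals all_analysis.
From mathcomp Require Import measurable_realfun ring lra.
Import numFieldNormedType.Exports.
Import Order.TTheory GRing.Theory Num.Theory.
Local Open Scope classical_set_scope.
Local Open Scope ring_scope.

(** Put c = 4(k-1)/k^2 and a = (k-2)/k, so that a^2 = 1 - c.  Since
    x^n/(1-x) - x^(n+1)/(1-x) = x^n, consecutive moments differ by a Beta
    integral, a multiple of a Catalan number; the zeroth moment is elementary
    in t = sqrt(x/(c-x)).  All the integrals on ]0, c[ are computed from
    primitives having limits at both endpoints.  On the other side, Leibniz'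
    rule gives P_(n+1) = X(1+X) P_n' + (n+1)(2+X) P_n, and P_n' can be
    eliminated from it by a first order differential equation for P_n.  The
    resulting recurrence, at X = a, is the one satisfied by the moments. *)

(** * The polynomials P_n: degree, differential equation and recurrence *)

Fixpoint rodrigues (R : comNzRingType) (n : nat) : {poly R} :=
  if n is m.+1 then
    'X * (1 + 'X) * (rodrigues R m)^`() + m.+1%:R * (2 + 'X) * rodrigues R m
  else 1.

(* The double factorial (2n+1)!!. *)
Fixpoint odd_fact (n : nat) : nat :=
  if n is m.+1 then (n.*2.+1 * odd_fact m)%N else 1%N.

(** The leading coefficient is multiplied by n + (n+1) from P_n to P_(n+1), so its positivity goes
    through the induction together with the size bound. *)
Lemma size_rodrigues (R : numDomainType) n : size (rodrigues R n) = n.+1.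
Proof.
suff [sP cP] : (size (rodrigues R n) <= n.+1)%N /\ 0 < (rodrigues R n)`_n.
  apply/eqP; rewrite eqn_leq sP ltnNge; apply/negP => /leq_sizeP/(_ n (leqnn n)).
  by move=> c0; rewrite c0 ltxx in cP.
elim: n => [|n [sP cP]]; first by rewrite /= size_poly1 coefC.
set p := rodrigues R n in sP cP.
have cpS i : (n < i)%N -> p`_i = 0 by move/(leq_sizeP _ _ sP).
have coefS i : (rodrigues R n.+1)`_i.+1 =
    (p`_i.+1 *+ i.+1 + (p`_i *+ i)) + n.+1%:R * (2 * p`_i.+1 + p`_i).
  have -> : rodrigues R n.+1 = 'X * p^`() + 'X * ('X * p^`()) +
      ((p *+ 2) *+ n.+1 + ('X * p) *+ n.+1) by rewrite /= -/p; ring.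
  rewrite !coefD !coefMn !coefXM /= coef_deriv.
  by case: i => [|i] /=; rewrite ?coef_deriv; ring.
split.
  apply/leq_sizeP => -[//|i] ni.
  by rewrite coefS !cpS ?(ltnW ni)// !(mul0rn, mulr0, addr0).
rewrite coefS cpS // mul0rn add0r mulr0 add0r -[_ *+ n]mulr_natl -mulrDl.
by rewrite mulr_gt0// -natrD ltr0n addnS.
Qed.

Lemma deriv_natr (R : nzRingType) n : (n%:R : {poly R})^`() = 0.
Proof. by rewrite -[n%:R]mulr1n -polyC_natr derivC. Qed.

(** Induction on [n]: P_(n+1) and its derivative are combinations of P_n, P_n' and P_n'', which the
    induction hypothesis and its derivative relate. *)
Lemma rodrigues_ode (R : comNzRingType) n :
  (1 - 'X) * (rodrigues R n)^`() =
  n.+1%:R * rodrigues R n - (odd_fact n)%:R * (1 + 'X) ^+ n.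
Proof.
elim: n => [|n E]; first by rewrite /= derivC expr0 mulr0; ring.
have E' := congr1 (@deriv R) E.
rewrite /=; set p := rodrigues R n in E E' *; set k := odd_fact n in E E' *.
move: E'; rewrite !(derivM, derivB, derivD, derivX, deriv_natr, derivC).
(* The extra factor 1 + X avoids the exponent n-1, and thus a separate case n = 0 further on. *)
have dX : ((1 + 'X : {poly R}) ^+ n)^`() * (1 + 'X) = n%:R * (1 + 'X) ^+ n.
  rewrite deriv_exp derivD derivX derivC add0r mul1r.
  by case: n {p k E} => [|n]; [rewrite mulr0n; ring | rewrite /= [in RHS]exprS; ring].
set d := (_ ^+ n)^`() in dX *; set e := (p^`())^`() => E'.
apply/eqP; rewrite -subr_eq0; apply/eqP.
have -> : (n.+1.*2.+1 * k)%:R = (2 * n%:R + 3) * k%:R :> {poly R}.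
  by rewrite natrM -mul2n -natr1 natrM -natr1; ring.
have -> : n.+2%:R = n%:R + 2 :> {poly R} by rewrite -addn2 natrD.
rewrite exprS; rewrite -[n.+1%:R]natr1 in E E' *.
set q := p^`() in E E' *; set w := (1 + 'X) ^+ n in E dX *.
(* Three vanishing brackets: the derivative of the induction hypothesis, the hypothesis itself, and
   [dX]. The multiplier X(1+X) of the first is dictated by the term in P_n''. *)
transitivity ('X * (1 + 'X) * ((0 - 1) * q + (1 - 'X) * e -
    (0 * p + (n%:R + 1%:R) * q - (0 * w + k%:R * d))) +
   (n%:R * (2 + 'X) + 3 + 3 * 'X) * ((1 - 'X) * q -
     ((n%:R + 1%:R) * p - k%:R * w)) +
   'X * k%:R * (n%:R * w - d * (1 + 'X))); last by rewrite E' E dX; ring.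
ring.
Qed.

(** After multiplication by 1 - X, [rodrigues_ode] removes P_n', and the coefficient of P_n
    collapses because X(1+X) + (1-X)(2+X) = 2. Being free of derivatives, the recurrence can be
    evaluated at a single point. *)
Lemma rodrigues_rec (R : comNzRingType) n :
  (1 - 'X) * rodrigues R n.+1 =
  (2 * n.+1)%:R * rodrigues R n - (odd_fact n)%:R * 'X * (1 + 'X) ^+ n.+1.
Proof.
have E := rodrigues_ode R n; rewrite /=.
transitivity ('X * (1 + 'X) * ((1 - 'X) * (rodrigues R n)^`()) +
  n.+1%:R * (1 - 'X) * (2 + 'X) * rodrigues R n); first by ring.
rewrite E natrM exprS; ring.
Qed.

(** * Iterated derivatives of z^n/(1 + sqrt z) for z > 0 *)

Section sqrt_calculus.
Variable R : realType.
Implicit Types (f : R -> R) (q r : {poly R}) (y z : R).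

Definition smooth_pos f := forall m z, 0 < z -> derivable (derive1n m f) z 1.

Lemma near_pos (P : R -> Prop) (z : R) : 0 < z -> (forall t, 0 < t -> P t) ->
  \near z, P z.
Proof.
by move=> z0 HP; near=> t; apply: HP; near: t; exact: lt_nbhsr.
Unshelve. all: by end_near. Qed.

(** Leibniz' rule with the identity as one factor, so that only two terms survive. As the formula
    holds at positive points only, the induction differentiates it on a neighbourhood. *)
Lemma derive1n_mul_id f n z : smooth_pos f -> 0 < z ->
  derive1n n.+1 (fun t => t * f t) z = z * derive1n n.+1 f z + n.+1%:R * derive1n n f z.
Proof.
move=> sf; elim: n z => [|n IH] z z0.
  rewrite derive1n1 derive1E.
  have /derivableP df := sf 0 z z0.
  rewrite (@derive_val _ _ _ _ _ _ _ (is_deriveM (is_derive_id z 1) df)).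
  by rewrite derive1n0 derive1n1 derive1E mul1r /= /GRing.scale /= mulr1.
rewrite derive1nS derive1E.
rewrite (@near_eq_derive _ _ _ _ (fun t : R =>
  t * derive1n n.+1 f t + n.+1%:R * derive1n n f t));
  last exact: near_pos.
have /derivableP d1 := sf n.+1 z z0.
have /derivableP d0 := sf n z z0.
rewrite (@derive_val _ _ _ _ _ _ _ (is_deriveD
  (is_deriveM (is_derive_id z 1) d1) (is_deriveM (is_derive_cst (n.+1%:R : R) z 1) d0))).
rewrite (derive1nS f n.+1) (derive1nS f n) !derive1E /= /GRing.scale /=.
rewrite -[n.+2%:R]natr1; ring.
Qed.

Lemma is_derive_comp_sqrt f df z : 0 < z -> is_derive (Num.sqrt z) 1 f df ->
  is_derive z 1 (fun t => f (Num.sqrt t)) (df / (2 * Num.sqrt z)).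
Proof.
by move=> z0 fd; apply: (is_derive1_comp fd); exact: is_derive1_sqrt.
Qed.

(** Quotients by powers of a fixed [r] are closed under derivation, which allows induction on the
    order of the derivative. *)
Lemma is_derive_horner_div q r i y : r.[y] != 0 ->
  is_derive y 1 (fun y => q.[y] / r.[y] ^+ i)
   ((q^`() * r - i%:R * q * r^`()).[y] / r.[y] ^+ i.+1).
Proof.
move=> r0.
have d2 : is_derive y 1 (fun y => r.[y] ^+ i) (i%:R * r.[y] ^+ i.-1 * r^`().[y]).
  by have := @is_deriveX _ _ _ i _ _ _ (is_derive_poly r y); rewrite exprfctE.
have d3 := @is_deriveV _ (fun y => r.[y] ^+ i) y _ 1 (expf_neq0 i r0) d2.
apply: (is_derive_eq (is_deriveM (is_derive_poly q y) d3)).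
rewrite /GRing.scale /= !hornerE hornerMn hornerC.
case: i {d2 d3} => [|i] /=; first by rewrite mulr0n expr0 expr1; field.
by rewrite !exprS; field; rewrite expf_neq0.
Qed.

(** Every iterated derivative has the form q(y)/r(y)^i with y = sqrt z and r = X(1+X); the factor X
    of r absorbs the 1/(2y) of the chain rule. *)
Lemma smooth_pos_rodrigues n : smooth_pos (fun t => t ^+ n / (1 + Num.sqrt t)).
Proof.
set f := fun t => _; set r : {poly R} := 'X * (1 + 'X).
have r0 z : 0 < z -> r.[Num.sqrt z] != 0.
  by rewrite -sqrtr_gt0 => z0; rewrite !hornerE gt_eqF// mulr_gt0// addr_gt0.
have dqr q i z : 0 < z ->
  is_derive z 1 (fun t => q.[Num.sqrt t] / r.[Num.sqrt t] ^+ i)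
   ((q^`() * r - i%:R * q * r^`()).[Num.sqrt z] / r.[Num.sqrt z] ^+ i.+1 /
    (2 * Num.sqrt z)).
  move=> z0; apply: (@is_derive_comp_sqrt (fun y => q.[y] / r.[y] ^+ i)) => //.
  exact: is_derive_horner_div (r0 z z0).
suff H m : exists q i, forall z, 0 < z -> derive1n m f z = q.[Num.sqrt z] / r.[Num.sqrt z] ^+ i.
  move=> m z z0; have [q [i Hqi]] := H m.
  apply: (@near_eq_derivable _ _ _ (fun t : R => q.[Num.sqrt t] / r.[Num.sqrt t] ^+ i)).
  - by apply: near_pos => // t t0; rewrite Hqi.
  - by case: (dqr q i z z0).
elim: m => [|m [q [i Hqi]]].
  (* Here z^n = y^(2n), and one more factor y completes the denominator 1 + y to r(y). *)
  exists ('X ^+ (2 * n).+1), 1%N => z z0; rewrite derive1n0 /f !hornerE expr1.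
  have s0 : 0 < Num.sqrt z by rewrite sqrtr_gt0.
  rewrite -[in LHS](sqr_sqrtr (ltW z0)) -exprM sqrtr_sqr ger0_norm ?ltW// exprS; field.
  by rewrite !gt_eqF// addr_gt0.
(* Since 1/(2y) = (1+y)/(2 r(y)), the chain rule costs a factor (1+X)/2 and a second power of r. *)
exists ((q^`() * r - i%:R * q * r^`()) * (1 + 'X) * 2^-1%:P), i.+2 => z z0.
rewrite derive1nS derive1E.
rewrite (@near_eq_derive _ _ _ _ (fun t : R => q.[Num.sqrt t] / r.[Num.sqrt t] ^+ i));
  last exact: near_pos.
rewrite (@derive_val _ _ _ _ _ _ _ (dqr q i z z0)).
move: (q^`() * r - _) => u; rewrite !hornerM hornerC hornerX !exprS.
have -> : (1 + 'X).[Num.sqrt z] = 1 + Num.sqrt z by rewrite !hornerE.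
have s0 : 0 < Num.sqrt z by rewrite sqrtr_gt0.
have : (Num.sqrt z * (1 + Num.sqrt z)) ^+ i != 0.
  by rewrite expf_neq0// mulf_neq0// gt_eqF// addr_gt0.
move: (_ ^+ i) => w w0; field.
by rewrite w0 !gt_eqF// addr_gt0.
Qed.

(** With y = sqrt z and d/dz = (1/(2y)) d/dy, [derive1n_mul_id] yields the numerator y(1+y)P_n' +
    (n+1)(2+y)P_n over 2^(n+1) (1+y)^(n+2), which is the recursion defining [rodrigues]. *)
Lemma derive1n_rodrigues n z : 0 < z ->
  derive1n n (fun t : R => t ^+ n / (1 + Num.sqrt t)) z =
  (rodrigues R n).[Num.sqrt z] / (2 ^+ n * (1 + Num.sqrt z) ^+ n.+1).
Proof.
elim: n z => [|n IH] z z0.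
  by rewrite derive1n0 /= !expr0 !hornerE ?mul1r ?expr1.
set f := fun t : R => t ^+ n / (1 + Num.sqrt t) in IH.
rewrite (_ : (fun t => _) = (fun t => t * f t)); last first.
  by apply/funext => t; rewrite /f exprS mulrA.
rewrite derive1n_mul_id//; last exact: smooth_pos_rodrigues.
rewrite derive1nS derive1E IH//.
pose p := rodrigues R n; pose g y := (p.[y] / (1 + 'X).[y] ^+ n.+1) / 2 ^+ n.
rewrite (@near_eq_derive _ _ _ _ (fun t : R => g (Num.sqrt t))); last first.
  apply: near_pos => // t t0; rewrite IH// /g !hornerE.
  by rewrite invfM mulrCA mulrC -/p.
have s0 : 0 < Num.sqrt z by rewrite sqrtr_gt0.
have r0 : (1 + 'X).[Num.sqrt z] != 0 by rewrite !hornerE gt_eqF// addr_gt0.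
have dg := is_deriveM (@is_derive_horner_div p _ n.+1 _ r0) (is_derive_cst (2 ^- n : R) _ _).
rewrite (@derive_val _ _ _ _ _ _ _ (@is_derive_comp_sqrt g _ _ z0 dg)).
rewrite /GRing.scale /= -/p derivD derivX derivC add0r mulr1.
have zE : z = Num.sqrt z * Num.sqrt z by rewrite -expr2 sqr_sqrtr ?ltW.
move: (Num.sqrt z) zE s0 {r0 dg} => y -> s0.
have y1 : 1 + y != 0 by rewrite gt_eqF// addr_gt0.
have -> : (1 + 'X).[y] = 1 + y by rewrite !hornerE.
have := expf_neq0 n y1; rewrite !exprS; move: (_ ^+ n) => w w0.
have : 2 ^+ n != 0 :> R by rewrite expf_neq0.
move: (2 ^+ n) => v v0; rewrite !(hornerD, hornerM, hornerN, hornerX, hornerMn, hornerC).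
field.
by rewrite w0 v0 y1 gt_eqF.
Qed.

End sqrt_calculus.

(** * Improper integrals of nonnegative functions *)

Section improper.
Variable R : realType.
Local Notation mu := (@lebesgue_measure R).

(** Closed subintervals exhaust the open one; the usual theorem applies on each, and monotone
    convergence passes to the limit. In this way [f] may be unbounded at the endpoints. *)
Lemma ge0_FTC2_oo (f F : R -> R) (a b A B : R) : a < b ->
  {in `]a, b[, forall x, 0 <= f x} ->
  {in `]a, b[, continuous f} ->
  {in `]a, b[, forall x : R, is_derive x 1 F (f x)} ->
  F x @[x --> a^'+] --> A -> F x @[x --> b^'-] --> B ->
  (\int[mu]_(x in `]a, b[) (f x)%:E = (B - A)%:E)%E.
Proof.
move=> ab f0 cf dF FA FB.
(* A denominator of at least 3 gives 2 e_n < b - a, so even the first subinterval is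
   nondegenerate. *)
pose e n : R := (b - a) / n.+3%:R.
have ba : 0 < b - a by rewrite subr_gt0.
have e0 n : 0 < e n by rewrite divr_gt0.
have e2 n : e n + e n < b - a.
  rewrite /e -mulrDl ltr_pdivrMr//.
  by have : 3 <= n.+3%:R :> R; [rewrite ler_nat|nra].
have ndec m n : (m <= n)%N -> e n <= e m.
  by move=> mn; rewrite ler_pM2l// lef_pV2 ?posrE// ler_nat !ltnS.
have ecvg : e n @[n --> \oo] --> 0.
  rewrite -[X in _ --> X](mulr0 (b - a)); apply: cvgMr.
  have := @cvg_harmonic R; rewrite -(cvg_shiftn 2).
  by apply: cvg_trans; apply: near_eq_cvg; apply: nearW => n; rewrite /= addn2.
pose S n := `[a + e n, b - e n]%classic.
have SE : \bigcup_n S n = `]a, b[%classic.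
  apply/seteqP; split => [x [n _]|x]; rewrite /S /= !in_itv/= => /andP[h1 h2].
    by have := e0 n; lra.
  have m0 : 0 < Num.min (x - a) (b - x) by rewrite lt_min !subr_gt0 h1.
  have /cvgr0Pnorm_lt /(_ _ m0) [n _ /(_ n (leqnn n))] := ecvg.
  rewrite /= ger0_norm ?ltW// lt_min => /andP[h3 h4].
  by exists n => //; rewrite /S /= in_itv/=; lra.
have Sab n x : x \in `[a + e n, b - e n] -> x \in `]a, b[.
  by rewrite !in_itv /= => /andP[h1 h2]; have := e0 n; lra.
have cFx x : x \in `]a, b[ -> {for x, continuous F}.
  move=> xab; have [dx _] := dF x xab.
  by apply/differentiable_continuous/derivable1_diffP.
have uv n : a + e n < b - e n by have := e2 n; lra.
have intS n : (\int[mu]_(x in S n) (f x)%:E = (F (b - e n))%:E - (F (a + e n))%:E)%E.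
  apply: continuous_FTC2 (uv n) _ _ _.
  - by apply: continuous_in_subspaceT => x /[!inE] xS; apply: cf; exact: Sab xS.
  - split.
    + move=> x xS; have [] := dF x _ => //.
      by apply: (Sab n); exact: subset_itv_oo_cc xS.
    + apply: cvg_at_right_filter; apply: cFx; apply: (Sab n).
      by rewrite in_itv/= lexx ltW.
    + apply: cvg_at_left_filter; apply: cFx; apply: (Sab n).
      by rewrite in_itv/= lexx ltW.
  - move=> x xS; rewrite derive1E; have xab : x \in `]a, b[.
      by apply: (Sab n); exact: subset_itv_oo_cc xS.
    by have [] := dF x xab.
have mS n : measurable_fun (S n : set (measurableTypeR R)) f.
  apply: (measurable_funS (E := `]a, b[%classic)) => //.
    by rewrite -SE; exact: bigcup_sup.
  by apply: open_continuous_measurable_fun => // x /[!inE]; exact: cf.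
have cvgS : (\int[mu]_(x in S n) (f x)%:E @[n --> \oo] -->
    \int[mu]_(x in \bigcup_n S n) (f x)%:E)%E.
  apply: ge0_nondecreasing_set_cvg_integral => //.
  - apply/nondecreasing_seqP => n; apply/subsetPset => x.
    by rewrite /S /= !in_itv/= => /andP[h1 h2]; have := ndec n n.+1 (leqnSn n); lra.
  - by move=> n; rewrite /S; apply: measurable_itv.
  - by move=> n; apply/measurable_EFinP.
  - by move=> n x xS; rewrite lee_fin f0//; exact: Sab xS.
rewrite SE in cvgS; apply: cvg_unique cvgS _ => //.
apply: (@cvg_trans _ ((F (b - e n) - F (a + e n))%:E @[n --> \oo])).
  by apply: near_eq_cvg; apply: nearW => n; rewrite /= EFinB; exact/esym/intS.
apply: cvg_EFin; first exact: nearW.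
apply: cvgB.
- move/cvg_at_leftP : FB; apply; split=> [n|]; first by rewrite gtrBl.
  by rewrite -[X in _ --> X]subr0; apply: cvgB => //; exact: cvg_cst.
- move/cvg_at_rightP : FA; apply; split=> [n|]; first by rewrite ltrDl.
  by rewrite -[X in _ --> X]addr0; apply: cvgD => //; exact: cvg_cst.
Unshelve. all: by end_near. Qed.

End improper.

(** * A product rule and the ratio of central binomial coefficients *)

Lemma is_derive1M {R : realType} {f g : R -> R} {x df dg : R} :
  is_derive x 1 f df -> is_derive x 1 g dg ->
  is_derive x 1 (fun x => f x * g x) (f x * dg + df * g x).
Proof.
by move=> df' dg'; apply: (is_derive_eq (is_deriveM df' dg')); rewrite [in RHS](mulrC df).
Qed.

Lemma central_binS n : (n.+1 * 'C(2 * n.+1, n.+1) = 2 * (2 * n).+1 * 'C(2 * n, n))%N.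
Proof.
have H m : ('C(2 * m, m) * (m`! * m`!) = (2 * m)`!)%N.
  by rewrite -[RHS](@bin_fact _ m) ?leq_pmull// mul2n -addnn addnK.
have f0 : (0 < n`! * n`!)%N by rewrite muln_gt0 fact_gt0.
apply/eqP; rewrite -(eqn_pmul2r f0) -(eqn_pmul2r (ltn0Sn n)); apply/eqP.
have := H n.+1; rewrite mulnS add2n !factS -H.
move: (binomial _ _) (binomial _ _) (n`!) => p q f E.
by transitivity (q * (n.+1 * f * (n.+1 * f)))%N; [ring | rewrite E; ring].
Qed.

(** * Primitives on ]0, c[ and their limits at the endpoints *)

Section primitives.
Variable R : realType.
Variables c a : R.
Hypotheses (c0 : 0 < c) (c1 : c <= 1) (ac : a ^+ 2 = 1 - c) (a0 : 0 <= a).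

(** Here [v] stands for the improper integral of [f] on ]0, c[. This form is linear in [f] without
    any sign or integrability condition, which suits the sign-changing functions met in integration
    by parts. *)
Definition has_primitive (f : R -> R) (v : R) := exists F : R -> R,
  [/\ {in `]0, c[, forall x : R, is_derive x 1 F (f x)},
      F x @[x --> 0^'+] --> (0 : R) & F x @[x --> c^'-] --> v].

Lemma has_primitive_lin {f g h u v} (r s : R) :
  has_primitive f u -> has_primitive g v ->
  {in `]0, c[, forall x, h x = r * f x + s * g x} ->
  has_primitive h (r * u + s * v).
Proof.
move=> [F [dF F0 Fc]] [G [dG G0 Gc]] hE.
exists (fun x => r * F x + s * G x); split.
- move=> x xc; apply: (is_derive_eq (is_deriveD
    (is_deriveM (is_derive_cst r x 1) (dF x xc))
    (is_deriveM (is_derive_cst s x 1) (dG x xc)))).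
  by rewrite hE// /GRing.scale /= !mulr0 !addr0.
- rewrite [X in _ --> X](_ : _ = r * 0 + s * 0); last by rewrite !mulr0 addr0.
  by apply: cvgD; apply: cvgMr.
- by apply: cvgD; apply: cvgMr.
Qed.

Let y := @Num.sqrt R.
Let s x := Num.sqrt (c - x).
Let t x := y x / s x.

(** Eliminating x and c in favour of the two square roots turns the derivative identities below into
    rational identities that [field] can decide. *)
Lemma sqrt_decomp {x} : x \in `]0, c[ ->
  [/\ 0 < y x, 0 < s x, x = y x ^+ 2 & c = y x ^+ 2 + s x ^+ 2].
Proof.
rewrite in_itv/= => /andP[x0 xc].
rewrite /y /s !sqr_sqrtr ?subr_ge0 ?ltW// !sqrtr_gt0 subr_gt0; split => //.
by rewrite addrC subrK.
Qed.

Lemma is_derive_y {x} : x \in `]0, c[ -> is_derive x 1 y (2 * y x)^-1.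
Proof. by rewrite in_itv/= => /andP[x0 xc]; exact: is_derive1_sqrt. Qed.

Lemma is_derive_s {x} : x \in `]0, c[ -> is_derive x 1 s (- (2 * s x)^-1).
Proof.
rewrite in_itv/= => /andP[x0 xc].
have d1 : is_derive x 1 (fun x : R => c - x) (-1).
  by apply: (is_derive_eq (is_deriveB (is_derive_cst c x 1) (is_derive_id x 1))); rewrite sub0r.
have d2 : is_derive (c - x) 1 Num.sqrt (2 * s x)^-1.
  by apply: is_derive1_sqrt; rewrite subr_gt0.
rewrite -mulrN1; exact: (@is_derive1_comp _ Num.sqrt (fun x => c - x) x _ _ d2 d1).
Qed.

Lemma is_derive_t {x} : x \in `]0, c[ -> is_derive x 1 t (c / (2 * y x * s x ^+ 3)).
Proof.
move=> xc; have [y0 s0 xE cE] := sqrt_decomp xc.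
have d1 := @is_deriveV _ s x _ 1 (lt0r_neq0 s0) (is_derive_s xc).
apply: (is_derive_eq (is_deriveM (is_derive_y xc) d1)).
rewrite /GRing.scale /= [in RHS]cE; field.
by rewrite !gt_eqF.
Qed.

(** Meant for b = 1, where s^2 + b^2 y^2 = c, and for b = a, where it equals c(1-x) and so produces
    the pole of the density. *)
Lemma is_derive_atan_t b {x} : x \in `]0, c[ ->
  is_derive x 1 (fun x => atan (b * t x))
    (b * c / (2 * y x * s x * (s x ^+ 2 + b ^+ 2 * y x ^+ 2))).
Proof.
move=> xc; have [y0 s0 xE cE] := sqrt_decomp xc.
have d1 : is_derive x 1 (fun x => b * t x) (b * (c / (2 * y x * s x ^+ 3))).
  apply: (is_derive_eq (is_deriveM (is_derive_cst b x 1) (is_derive_t xc))).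
  by rewrite /GRing.scale /= mulr0 addr0.
apply: (is_derive_eq (@is_derive1_comp _ atan (fun x => b * t x) x _ _ (is_derive1_atan _) d1)).
rewrite /t.
have h : s x ^+ 2 + b ^+ 2 * y x ^+ 2 != 0.
  by rewrite gt_eqF// ltr_wpDr ?exprn_gt0// mulr_ge0 ?sqr_ge0.
by field; rewrite exprMn h !gt_eqF.
Qed.

Lemma y_cvg0 : y x @[x --> 0^'+] --> (0 : R).
Proof.
by apply: cvg_at_right_filter; rewrite -[X in _ --> X](@sqrtr0 R); exact: sqrt_continuous.
Qed.

Lemma y_cvgc : y x @[x --> c^'-] --> y c.
Proof. by apply: cvg_at_left_filter; exact: sqrt_continuous. Qed.

Lemma s_continuous : continuous s.
Proof.
move=> x; apply: continuous_comp; last exact: sqrt_continuous.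
by apply: cvgB; [exact: cvg_cst|exact: cvg_id].
Qed.

Lemma s_cvg0 : s x @[x --> 0^'+] --> y c.
Proof. by apply: cvg_at_right_filter; rewrite -[X in y X]subr0; exact: s_continuous. Qed.

Lemma s_cvgc : s x @[x --> c^'-] --> (0 : R).
Proof.
by apply: cvg_at_left_filter; rewrite -[X in _ --> X](@sqrtr0 R) -(subrr c); exact: s_continuous.
Qed.

Lemma t_cvg0 : t x @[x --> 0^'+] --> (0 : R).
Proof.
rewrite -[X in _ --> X](mul0r (y c)^-1); apply: cvgM; first exact: y_cvg0.
by apply: cvgV; [rewrite gt_eqF// sqrtr_gt0|exact: s_cvg0].
Qed.

Lemma t_cvgc : t x @[x --> c^'-] --> +oo.
Proof.
apply/gtr0_cvgV0.
  near=> x; have xc : x \in `]0, c[ by rewrite in_itv/=; apply/andP; split; near: x; [exact: nbhs_left_gt|exact: nbhs_left_lt].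
  by have [y0 s0 _ _] := sqrt_decomp xc; rewrite divr_gt0.
rewrite -[X in _ --> X](mul0r (y c)^-1).
apply: (@cvg_trans _ ((s x * (y x)^-1) @[x --> c^'-])).
  by apply: near_eq_cvg; apply: nearW => x; rewrite /t /= invfM invrK mulrC.
apply: cvgM; first exact: s_cvgc.
by apply: cvgV; [rewrite gt_eqF// sqrtr_gt0|exact: y_cvgc].
Unshelve. all: by end_near. Qed.

Lemma atan_t_cvg0 b : atan (b * t x) @[x --> 0^'+] --> (0 : R).
Proof.
rewrite -[X in _ --> X](@atan0 R).
apply: continuous_cvg; first exact: continuous_atan.
by rewrite -[X in _ --> X](mulr0 b); apply: cvgMr; exact: t_cvg0.
Qed.

Lemma atan_t_cvgc b : 0 < b -> atan (b * t x) @[x --> c^'-] --> pi / 2.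
Proof.
move=> b0; apply: (cvg_comp _ _ _ (@cvgy_atan R)).
by apply: gt0_cvgMry => //; exact: t_cvgc.
Qed.

Definition xpow_sqrt n x := x ^+ n * (s x / y x).

(* The total mass of [xpow_sqrt n] on ]0, c[, divided by pi. *)
Definition wallis n : R := 2 * (c / 4) ^+ n.+1 * 'C(2 * n, n)%:R / n.+1%:R.

Lemma wallisS n : wallis n.+1 = (n%:R + 2^-1) * c / n.+2%:R * wallis n.
Proof.
have := congr1 (fun m => m%:R : R) (central_binS n); rewrite !natrM -natr1 => E.
have n1 : n%:R + 1 != 0 :> R by rewrite natr1 pnatr_eq0.
have n2 : n%:R + 2 != 0 :> R by rewrite -natrD addn2 pnatr_eq0.
rewrite /wallis (_ : 'C(2 * n.+1, n.+1)%:R = 2 * (2 * n).+1%:R * 'C(2 * n, n)%:R / (n%:R + 1)); last first.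
  by rewrite -E; field.
rewrite -[(2 * n).+1%:R]natr1 natrM -addn2 natrD -natr1 exprS.
move: (_ ^+ n.+1) => w; field.
by rewrite !(addrC _ n%:R) n1 n2.
Qed.

(** Integration by parts gives the ratio of consecutive integrals, which is that of [wallisS]. *)
Lemma primitive_xpow_sqrt n : has_primitive (xpow_sqrt n) (pi * wallis n).
Proof.
elim: n => [|n IH].
  exists (fun x => y x * s x + c * atan (1 * t x)); split.
  - move=> x xc; have [y0 s0 xE cE] := sqrt_decomp xc.
    apply: (is_derive_eq (is_deriveD (is_deriveM (is_derive_y xc) (is_derive_s xc))
      (is_deriveM (is_derive_cst c x 1) (is_derive_atan_t 1 xc)))).
    rewrite /GRing.scale /= /xpow_sqrt expr0.
    move: (y x) (s x) y0 s0 cE => u v u0 v0 ->; field.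
    by rewrite !gt_eqF ?addr_gt0 ?exprn_gt0.
  - rewrite [X in _ --> X](_ : _ = 0 * y c + c * 0); last by ring.
    apply: cvgD; first by apply: cvgM; [exact: y_cvg0|exact: s_cvg0].
    by apply: cvgMr; exact: atan_t_cvg0.
  - rewrite [X in _ --> X](_ : _ = y c * 0 + c * (pi / 2)); last first.
      by rewrite /wallis expr1 bin0; field.
    apply: cvgD; first by apply: cvgM; [exact: y_cvgc|exact: s_cvgc].
    by apply: cvgMr; exact: atan_t_cvgc.
(* This is the derivative of x^n y s^3, which tends to 0 at both endpoints. Writing f_n for
   [xpow_sqrt n], it equals (n + 1/2) c f_n - (n+2) f_(n+1), hence the coefficients used below. *)
pose h x := n%:R * x ^+ n.-1 * (y x * s x ^+ 3) + x ^+ n * (s x ^+ 3 / (2 * y x) - 3 / 2 * y x * s x).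
have prim_h : has_primitive h 0.
  exists (fun x => x ^+ n * (y x * s x ^+ 3)); split.
  - move=> x xc; have [y0 s0 xE cE] := sqrt_decomp xc.
    have d3 : is_derive x 1 (fun x => s x ^+ 3) (3 * s x ^+ 2 * - (2 * s x)^-1).
      by have := @is_deriveX _ _ _ 3 _ _ _ (is_derive_s xc); rewrite exprfctE.
    have dn : is_derive x 1 (fun x => x ^+ n) (n%:R * x ^+ n.-1).
      by have := @is_deriveX _ _ _ n _ _ _ (is_derive_id x 1); rewrite exprfctE /GRing.scale /= mulr1.
    apply: (is_derive_eq (is_derive1M dn (is_derive1M (is_derive_y xc) d3))).
    rewrite /h; move: (x ^+ n) (x ^+ n.-1) => u v; field.
    by rewrite !gt_eqF.
  - rewrite [X in _ --> X](_ : _ = 0 ^+ n * (0 * y c ^+ 3)); last by ring.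
    apply: cvgM; first by apply: cvg_at_right_filter; exact: exprn_continuous.
    apply: cvgM; first exact: y_cvg0.
    exact: (@continuous_cvg _ _ _ _ _ s (fun u => u ^+ 3) _ (@exprn_continuous R 3 _) s_cvg0).
  - rewrite [X in _ --> X](_ : _ = c ^+ n * (y c * 0 ^+ 3)); last by rewrite expr0n mulr0 mulr0.
    apply: cvgM; first by apply: cvg_at_left_filter; exact: exprn_continuous.
    apply: cvgM; first exact: y_cvgc.
    exact: (@continuous_cvg _ _ _ _ _ s (fun u => u ^+ 3) _ (@exprn_continuous R 3 _) s_cvgc).
have n2 : n.+2%:R != 0 :> R by rewrite pnatr_eq0.
rewrite wallisS (_ : pi * _ = ((n%:R + 2^-1) * c / n.+2%:R) * (pi * wallis n) + (- n.+2%:R^-1) * 0); last by ring.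
apply: (has_primitive_lin _ _ IH prim_h) => x xc; have [y0 s0 xE cE] := sqrt_decomp xc.
rewrite /xpow_sqrt /h.
move: (y x) (s x) y0 s0 xE cE => u v u0 v0 xE cE.
(* As x = u^2, the missing power of x is recovered from u; at n = 0 the factor [n%:R] kills the
   term. *)
have -> : n%:R * x ^+ n.-1 * (u * v ^+ 3) = n%:R * x ^+ n * (v ^+ 3 / u).
  case: (n) => [|m]; first by rewrite !mul0r.
  rewrite /= [x ^+ m.+1]exprS; move: (x ^+ m) => w; rewrite xE; field.
  by rewrite gt_eqF.
rewrite exprS; move: (x ^+ n) => w; rewrite xE {}cE.
rewrite -addn2 natrD in n2 *; field.
by rewrite n2 gt_eqF.
Qed.

Definition xpow_density n x := xpow_sqrt n x / (1 - x).

Lemma primitive_xpow_density n :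
  has_primitive (xpow_density n) (pi * (1 - a - \sum_(i < n) wallis i)).
Proof.
elim: n => [|n IH].
  (* In the variable t the integrand is 2c/((1+t^2)(1+a^2 t^2)) dt; as c = 1 - a^2, partial
     fractions give the two arctangents. *)
  exists (fun x => 2 * (atan (1 * t x) - a * atan (a * t x))); split.
  - move=> x xc; have [y0 s0 xE cE] := sqrt_decomp xc.
    apply: (is_derive_eq (is_deriveM (is_derive_cst (2 : R) x 1) (is_deriveB (is_derive_atan_t 1 xc)
      (is_deriveM (is_derive_cst a x 1) (is_derive_atan_t a xc))))).
    have x1 : 1 - x != 0.
      by rewrite gt_eqF// subr_gt0; move: xc; rewrite in_itv/= => /andP[_ /lt_le_trans]; exact.
    rewrite /GRing.scale /= /xpow_density /xpow_sqrt expr0.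
    move: (y x) (s x) y0 s0 xE cE => u v u0 v0 xE cE.
    have aE : v ^+ 2 + a ^+ 2 * u ^+ 2 = c * (1 - x) by rewrite ac xE cE; ring.
    rewrite !mulr0 !addr0 [a * (a * _ / _)]mulrA [a * (a * _)]mulrA -expr2 aE ac.
    have cn0 := c0; rewrite xE cE in cn0 x1 *; field.
    by rewrite x1 !gt_eqF.
  - rewrite [X in _ --> X](_ : _ = 2 * (0 - a * 0)); last by ring.
    apply: cvgMr; apply: cvgB; first exact: atan_t_cvg0.
    by apply: cvgMr; exact: atan_t_cvg0.
  - rewrite [X in _ --> X](_ : _ = 2 * (pi / 2 - a * (pi / 2))); last first.
      by rewrite big_ord0; field.
    apply: cvgMr; apply: cvgB; first exact: atan_t_cvgc.
    (* For a = 0 the arctangent stays at 0 instead of tending to pi/2, but its coefficient a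
       vanishes too. *)
    have [->|an0] := eqVneq a 0.
      rewrite mul0r; under eq_fun do rewrite mul0r; exact: cvg_cst.
    by apply: cvgMr; apply: atan_t_cvgc; rewrite lt_def an0.
rewrite (_ : pi * _ = 1 * (pi * (1 - a - \sum_(i < n) wallis i)) + (-1) * (pi * wallis n)); last first.
  by rewrite big_ord_recr /=; ring.
apply: (has_primitive_lin _ _ IH (primitive_xpow_sqrt n)) => x xc.
have x1 : 1 - x != 0.
  by rewrite gt_eqF// subr_gt0; move: xc; rewrite in_itv/= => /andP[_ /lt_le_trans]; exact.
by rewrite /xpow_density /xpow_sqrt exprS; move: (s x / y x) (x ^+ n) => u v; field.
Qed.

End primitives.

(** * The moments as finite sums *)

Lemma xpow_density_continuous (R : realType) (c : R) n : c <= 1 ->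
  {in `]0, c[, continuous (xpow_density R c n)}.
Proof.
move=> c1 x; rewrite in_itv/= => /andP[x0 xc].
apply: cvgM.
  apply: cvgM; first exact: exprn_continuous.
  apply: cvgM; first exact: s_continuous.
  by apply: cvgV; [rewrite gt_eqF// sqrtr_gt0|exact: sqrt_continuous].
apply: cvgV; first by rewrite subr_eq0 gt_eqF// (lt_le_trans xc).
by apply: cvgB; [exact: cvg_cst|exact: cvg_id].
Qed.

(** Since 4(k-1) - k^2 x = k^2 (c-x), the integrand is k times [xpow_density]; the factor pi of its
    integral cancels against 1/(2 pi). *)
Lemma moment_inftyE (R : realType) (k n : nat) (c := 4 * (k%:R - 1) / k%:R ^+ 2 : R) :
  (2 <= k)%N ->
  moment_infty R k n =
  (k%:R / 2 * (1 - (k%:R - 2) / k%:R - \sum_(i < n) wallis R c i))%:E.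
Proof.
move=> hk; have k2 : 2 <= k%:R :> R by rewrite ler_nat.
have k0 : 0 < k%:R :> R by rewrite (lt_le_trans _ k2).
have kn0 := lt0r_neq0 k0.
have c0 : 0 < c by apply: divr_gt0; [lra|exact: exprn_gt0].
have c1 : c <= 1
  by rewrite /c ler_pdivrMr ?exprn_gt0// mul1r; have := sqr_ge0 (k%:R - 2 : R); nra.
have ac : ((k%:R - 2) / k%:R) ^+ 2 = 1 - c by rewrite /c; field.
have a0 : 0 <= (k%:R - 2) / k%:R :> R by apply: divr_ge0; [lra|exact: ltW].
have [F [dF F0 Fc]] := primitive_xpow_density _ _ _ c0 c1 ac a0 n.
rewrite /moment_infty -/c.
have -> : (\int[lebesgue_measure]_(x in `]0%R, c[%classic)
     (x `^ (n%:R - 2^-1) *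
      (Num.sqrt (4 * (k%:R - 1) - k%:R ^+ 2 * x) / (1 - x)))%R%:E =
   \int[lebesgue_measure]_(x in `]0%R, c[%classic)
     (k%:R * xpow_density R c n x)%:E)%E.
  apply: eq_integral => x; rewrite inE/= in_itv/= => /andP[x0 xc].
  congr EFin; rewrite powRB; last by apply/implyP => _; rewrite gt_eqF.
  rewrite powR_mulrn ?ltW// powR12_sqrt ?ltW//.
  have -> : 4 * (k%:R - 1) - k%:R ^+ 2 * x = k%:R ^+ 2 * (c - x) by rewrite /c; field.
  rewrite sqrtrM ?sqr_ge0// sqrtr_sqr ger0_norm ?ltW//.
  by rewrite /xpow_density /xpow_sqrt; ring.
rewrite (ge0_FTC2_oo _ _ (fun x => k%:R * F x) _ _ (k%:R * 0)
  (k%:R * (pi * (1 - (k%:R - 2) / k%:R - \sum_(i < n) wallis R c i)))) //.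
- rewrite -EFinM; congr EFin.
  have := pi_gt0 R; move: (pi) => p p0; field.
  by rewrite kn0 gt_eqF.
- move=> x; rewrite in_itv/= => /andP[x0 xc].
  apply: mulr_ge0; first exact: ltW.
  apply: divr_ge0; last by rewrite subr_ge0 ltW// (lt_le_trans xc).
  by apply: mulr_ge0; [rewrite exprn_ge0// ltW|rewrite divr_ge0 ?sqrtr_ge0].
- move=> x xc; apply: cvgMr; exact: xpow_density_continuous.
- move=> x xc; apply: (is_derive_eq (is_derive1M (is_derive_cst (k%:R : R) x 1) (dF x xc))).
  by rewrite mul0r addr0.
- by apply: cvgMr.
- by apply: cvgMr.
Qed.

(** * Matching the finite sums with the values of P_n *)

Lemma odd_fact_bin n : (odd_fact n * 2 ^ n.+1 = 'C(2 * n.+1, n.+1) * n.+1`!)%N.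
Proof.
elim: n => [//|n IH].
rewrite [n.+2`!]factS mulnA [('C(_, _) * _)%N]mulnC central_binS expnS /= -mul2n.
transitivity (2 * (2 * n.+1).+1 * (odd_fact n * 2 ^ n.+1))%N; first by ring.
by rewrite IH; ring.
Qed.

(** The summand is [wallis] unfolded. Adding one term to the sum matches [rodrigues_rec] evaluated
    at a = (K-2)/K, where 1 - a = 2/K and 1 + a = 2(K-1)/K. *)
Lemma wallis_sumE (R : realFieldType) (K : R) n (c := 4 * (K - 1) / K ^+ 2) :
  K != 0 -> K != 1 ->
  K / 2 * (1 - (K - 2) / K - \sum_(i < n) (2 * (c / 4) ^+ i.+1 * 'C(2 * i, i)%:R / i.+1%:R)) =
  2 * (K - 1) ^+ n.+1 / K ^+ (2 * n).+1 *
         ('C(2 * n, n)%:R -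
          (K - 2) / (2 * n`!%:R * (K - 1) ^+ n.+1) * K ^+ n *
          (rodrigues R n).[(K - 2) / K]).
Proof.
move=> K0; rewrite -subr_eq0 => K1.
elim: n => [|n IH].
  rewrite big_ord0 /= muln0 bin0 fact0 hornerC !expr1 expr0.
  by field; rewrite K0 K1.
rewrite big_ord_recr [LHS]/=.
set S := \sum_(i < n) _ in IH *.
rewrite [LHS](_ : _ = K / 2 * (1 - (K - 2) / K - S) -
    K / 2 * (2 * (c / 4) ^+ n.+1 * 'C(2 * n, n)%:R / n.+1%:R)); last by ring.
rewrite IH.
move: (rodrigues R n.+1) (rodrigues R n) (rodrigues_rec R n) {S IH} => q p P.
have {}P := congr1 (fun p => p.[(K - 2) / K]) P.
rewrite /= !(hornerM, hornerD, hornerN, hornerX, hornerMn, horner_exp, hornerC) in P.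
have B : 'C(2 * n.+1, n.+1)%:R = 2 * (2 * n%:R + 1) * 'C(2 * n, n)%:R / (n%:R + 1) :> R.
  have := congr1 (fun m => m%:R : R) (central_binS n); rewrite !natrM -[n.+1%:R]natr1 -[(2 * n).+1%:R]natr1 natrM => E.
  by rewrite -E; field; rewrite natr1 pnatr_eq0.
have oddE : (odd_fact n)%:R = 'C(2 * n.+1, n.+1)%:R * (n%:R + 1) * n`!%:R / 2 ^+ n.+1 :> R.
  have := congr1 (fun m => m%:R : R) (odd_fact_bin n).
  rewrite factS !natrM natrX -[n.+1%:R]natr1 => E.
  rewrite mulrA in E; rewrite -E; field.
  by rewrite expf_neq0 ?pnatr_eq0.
rewrite {}oddE B in P *.
have -> : c / 4 = (K - 1) / K ^+ 2 by rewrite /c; field.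
have x1 : 1 + (K - 2) / K = 2 * (K - 1) / K by field.
(* The factor K/2 is the inverse of 1 - a; this exposes the left-hand side of the recurrence. *)
have qE : q.[(K - 2) / K] = K / 2 * ((1 - (K - 2) / K) * q.[(K - 2) / K]) by field.
rewrite qE P x1 {P qE x1 c}; move: (p.[_]) => r.
rewrite factS !natrM -[n.+1%:R]natr1.
have n1 : n%:R + 1 != 0 :> R by rewrite natr1 pnatr_eq0.
have f0 : n`!%:R != 0 :> R by rewrite pnatr_eq0 -lt0n fact_gt0.
have t0 : 2 ^+ n != 0 :> R by rewrite expf_neq0 ?pnatr_eq0.
have w0 := expf_neq0 n K1; have u0 := expf_neq0 n K0.
have k2n : K ^+ (2 * n) = K ^+ n * K ^+ n by rewrite mul2n -addnn exprD.
rewrite mulnS add2n !(expr_div_n, exprMn) !exprS k2n.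
move: (n%:R) n1 => v n1.
move: (n`!%:R) f0 => f f0.
move: (2 ^+ n) t0 => t t0.
move: ((K - 1) ^+ n) w0 => w w0.
move: (K ^+ n) u0 => u u0.
field.
by rewrite u0 K0 t0 n1 w0 K1 f0.
Qed.

Theorem mainTheorem10 (R : realType) (k : nat) (hk : (2 <= k)%N) (n : nat) :
  exists P : {poly R},
    [/\ size P = n.+1,
        forall z : R, 0 < z ->
          derive1n n (fun t : R => t ^+ n / (1 + Num.sqrt t)) z =
          P.[Num.sqrt z] / (2 ^+ n * (1 + Num.sqrt z) ^+ n.+1)
      & moment_infty R k n =
        (2 * (k%:R - 1) ^+ n.+1 / k%:R ^+ (2 * n).+1 *
         ('C(2 * n, n)%:R -
          (k%:R - 2) / (2 * n`!%:R * (k%:R - 1) ^+ n.+1) * k%:R ^+ n *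
          P.[(k%:R - 2) / k%:R]))%:E].
Proof.
exists (rodrigues R n); split.
- exact: size_rodrigues.
- by move=> z z0; exact: derive1n_rodrigues.
- have kR (m : nat) : (m < 2)%N -> k%:R != m%:R :> R.
    by move=> m2; rewrite eqr_nat gtn_eqF// (leq_trans m2).
  rewrite moment_inftyE// -wallis_sumE ?kR//.
  + exact: kR 0%N _.
  + exact: kR 1%N _.
Qed.
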